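(* Let $(X,\pi)$ be a weighted $n$-partite simplicial complex and let $I,J\subseteq[n]$ with $I\cap J=\emptyset$. Then $\cos(\mathcal U_I,\mathcal U_J)\le\varepsilon^{I\to J}$.
   Context: An $n$-partite simplicial complex $X$ is a downward-closed family of subsets of a finite vertex set whose inclusion-maximal faces all have size $n$, with vertices partitioned into sides $X[1],\dots,X[n]$ such that each face $\omega\in X^{(n)}$ of size $n$ contains exactly one vertex $\omega_i$ per side. $\mathrm{typ}(\alpha)=\{i:\alpha\cap X[i]\neq\emptyset\}$, $X[T]$ = faces of type $T$, $\alpha\oplus\beta$ = union of faces of disjoint types. $\pi$ is a full-support probability distribution on $X^{(n)}$; $\mathbb R^{X^{(n)}}$ carries $\langle f,g\rangle_\pi=\sum_\omega\pi(\omega)f(\omega)g(\omega)$. For $T\subseteq[n]$, $\mathcal U_T=\mathrm{span}\{u_\alpha:\alpha\in X[[n]\setminus T]\}$ where $u_\alpha(\omega)=\mathbf 1[\omega\supseteq\alpha]$ (functions depending only on coordinates outside $T$). For subspaces $\mathcal U,\mathcal V$, $\cos(\mathcal U,\mathcal V)=\max\{\langle u,v\rangle_\pi: u\in\mathcal U\cap(\mathcal U\cap\mathcal V)^\perp,\ v\in\mathcal V\cap(\mathcal U\cap\mathcal V)^\perp,\ \|u\|_\pi=\|v\|_\pi=1\}$. For a face $\alpha$ of type $S$ and $T\subseteq[n]\setminus S$: $X_\alpha[T]=\{\tau\in X[T]:\alpha\oplus\tau\in X\}$, $\pi^{(\alpha)}_T(\tau)=\Pr_{\omega\sim\pi}[\omega_T=\tau\mid\omega_S=\alpha]$.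 For disjoint $I,J\subseteq[n]\setminus\mathrm{typ}(\alpha)$, the colored walk $C^{I\to J}_\alpha\in\mathbb R^{X_\alpha[I]\times X_\alpha[J]}$ is $C^{I\to J}_\alpha(\tau_I,\tau_J)=\pi^{(\alpha\oplus\tau_I)}_J(\tau_J)$, with $\sigma_2(C^{I\to J}_\alpha)=\max\{\langle f,C^{I\to J}_\alpha g\rangle_{\pi^{(\alpha)}_I}:\|f\|_{\pi^{(\alpha)}_I}=\|g\|_{\pi^{(\alpha)}_J}=1,\ f\perp\mathbf 1,\ g\perp\mathbf 1\}$. Finally $\varepsilon^{I\to J}=\max_{\alpha\in X[[n]\setminus(I\cup J)]}\sigma_2(C^{I\to J}_\alpha)$. *)

(* Defs.v *)
From mathcomp Require Import all_boot all_order all_algebra.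
From mathcomp Require Import boolp classical_sets reals.

Set Implicit Arguments.
Unset Strict Implicit.
Unset Printing Implicit Defensive.

Import Order.TTheory GRing.Theory Num.Theory.

Local Open Scope ring_scope.

(* The side of a vertex is given by a function, so the sides partition V;
   they are indexed by 0, ..., n-1. *)
Record partite_complex (n : nat) (V : finType) := PartiteComplex {
  faces : {set {set V}};
  side : V -> 'I_n;
  faces_down : forall a b : {set V},
    b \in faces -> a \subset b -> a \in faces;
  faces_pure : forall a : {set V},
    maxset [pred b : {set V} | b \in faces] a -> #|a| = n;
  faces_partite : forall w : {set V}, w \in faces -> #|w| = n ->
    forall i : 'I_n, #|[set v in w | side v == i]| = 1%N
}.

Section Complex.
Variables (n : nat) (V : finType) (X : partite_complex n V).
Implicit Types (a t w : {set V}) (S T : {set 'I_n}).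

Definition typ a : {set 'I_n} := [set i | [exists v in a, side X v == i]].

Definition faces_of_type T : {set {set V}} := [set a in faces X | typ a == T].

Definition top_faces : {set {set V}} := [set w in faces X | #|w| == n].

Definition top_face := {w : {set V} | w \in top_faces}.

Definition proj T w : {set V} := [set v in w | side X v \in T].

Definition link_faces a T : {set {set V}} :=
  [set t in faces_of_type T | a :|: t \in faces X].

Definition link_face a T := {t : {set V} | t \in link_faces a T}.

End Complex.

Section Inner.
Variables (R : realType) (A : finType) (mu : A -> R).

(* R^o is R seen as a vector space over itself; this makes {ffun A -> R^o}
   a vectType over R. *)
Definition inner (f g : {ffun A -> R^o}) : R := \sum_x mu x * f x * g x.

Definition norm (f : {ffun A -> R^o}) : R := Num.sqrt (inner f f).

Definition full_support_distribution : Prop :=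
  (forall x, 0 < mu x) /\ \sum_x mu x = 1.

(* For positive mu this is a maximum over a compact set, except when no unit
   vectors u, v as below exist, in which case sup gives the value 0. *)
Definition cos_subspaces (U W : {vspace {ffun A -> R^o}}) : R :=
  sup [set r : R | exists u v : {ffun A -> R^o},
    [/\ u \in U /\ (forall z, z \in (U :&: W)%VS -> inner u z = 0),
        v \in W /\ (forall z, z \in (U :&: W)%VS -> inner v z = 0),
        norm u = 1, norm v = 1 & r = inner u v]]%classic.

End Inner.

Section Weighted.
Variables (R : realType) (n : nat) (V : finType) (X : partite_complex n V).
Variable (pi : top_face X -> R).
Implicit Types (a : {set V}) (T I J : {set 'I_n}).

Definition u_face a : {ffun top_face X -> R^o} :=
  [ffun w : top_face X => (a \subset val w)%:R].

Definition U_space T : {vspace {ffun top_face X -> R^o}} :=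
  <<[seq u_face a | a <- enum (faces_of_type X (~: T))]>>%VS.

Definition Pr (E : pred (top_face X)) : R := \sum_(w | E w) pi w.

Definition cond_Pr (E F : pred (top_face X)) : R :=
  Pr [pred w | E w && F w] / Pr F.

Definition link_dist a T (t : {set V}) : R :=
  cond_Pr [pred w | proj X T (val w) == t] [pred w | proj X (typ X a) (val w) == a].

Definition link_marginal a T (t : link_face X a T) : R := link_dist a T (val t).

Definition colored_walk a I J (tI : link_face X a I) (tJ : link_face X a J) : R :=
  link_dist (a :|: val tI) J (val tJ).

Definition walk_apply a I J (g : {ffun link_face X a J -> R^o}) :
    {ffun link_face X a I -> R^o} :=
  [ffun tI => \sum_tJ colored_walk tI tJ * g tJ].

(* For a in X this is a maximum over a compact set, except when the link of a
   has a single face of type I or of type J: no f or no g exists then, and sup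
   gives the value 0. *)
Definition sigma2 a I J : R :=
  sup [set r : R | exists (f : {ffun link_face X a I -> R^o})
                          (g : {ffun link_face X a J -> R^o}),
    [/\ norm (@link_marginal a I) f = 1, norm (@link_marginal a J) g = 1,
        inner (@link_marginal a I) f [ffun=> 1] = 0,
        inner (@link_marginal a J) g [ffun=> 1] = 0
      & r = inner (@link_marginal a I) f (walk_apply I g)]]%classic.

(* The supremum of a finite set, nonempty when X has a face. *)
Definition epsilon I J : R :=
  sup [set r : R | exists2 a : {set V},
    a \in faces_of_type X (~: (I :|: J)) & r = sigma2 a I J]%classic.

End Weighted.

(* Main.v *)
(* Condition on a face a of type S = [n] \ (I u J).  On the fibre of a, a
   function u in U_I depends only on the J-coordinates and v in U_J only on
   the I-coordinates, and E[u v | a] is the bilinear form <v, C_a^{I->J} u>.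
   The indicator u_a lies in both U_I and U_J, so orthogonality to their
   intersection makes the conditional means of u and v vanish.  Hence
   E[u v | a] <= sigma_2 ||u||_a ||v||_a <= eps (||u||_a^2 + ||v||_a^2) / 2,
   and averaging over a gives <u, v> <= eps for unit vectors. *)
Require Import Defs.
From mathcomp Require Import all_boot all_order all_algebra.
From mathcomp Require Import boolp classical_sets reals.
From mathcomp Require Import ring lra.

Set Implicit Arguments.
Unset Strict Implicit.
Unset Printing Implicit Defensive.

Import Order.TTheory GRing.Theory Num.Theory.

Local Open Scope ring_scope.

(** * Sums against a nonnegative weight, and scaling of the weighted inner product *)

Section WeightedSums.
Variables (R : realType) (A : finType) (mu : A -> R).
Hypothesis mu_ge0 : forall x, 0 <= mu x.
Implicit Types f g : A -> R.

Lemma weighted_sqr_ge0 f : 0 <= \sum_x mu x * f x * f x.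
Proof. by apply: sumr_ge0 => x _; rewrite -mulrA mulr_ge0 // -expr2 sqr_ge0. Qed.

(** Expand [mu x * (f x - g x) ^+ 2 >= 0]. For unit vectors this gives the same bound 1 as
    Cauchy-Schwarz. *)
Lemma weighted_AMGM f g :
  \sum_x mu x * f x * g x <=
  (\sum_x mu x * f x * f x + \sum_x mu x * g x * g x) / 2.
Proof.
rewrite -big_split /= mulr_suml; apply: ler_sum => x _.
by have := mu_ge0 x; have := sqr_ge0 (f x - g x); nra.
Qed.

(** Nonnegative terms with sum zero all vanish, so [mu x = 0] or [f x = 0] at every [x]. This serves
    the degenerate case of vectors that cannot be normalised. *)
Lemma weighted_sum_eq0 f g :
  \sum_x mu x * f x * f x = 0 -> \sum_x mu x * f x * g x = 0.
Proof.
move=> f0; apply: big1 => x _.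
have /eqP : mu x * f x * f x = 0.
  by apply: (psumr_eq0P _ f0) => // y _; rewrite -mulrA mulr_ge0 // -expr2 sqr_ge0.
by rewrite -mulrA !mulf_eq0 orbb => /orP[]/eqP->; rewrite ?mulr0 ?mul0r.
Qed.

End WeightedSums.

Lemma norm_sqr (R : realType) (A : finType) (mu : A -> R) (f : {ffun A -> R^o}) :
  (forall x, 0 <= mu x) -> norm mu f ^+ 2 = inner mu f f.
Proof. by move=> mu0; rewrite sqr_sqrtr //; apply: weighted_sqr_ge0. Qed.

Lemma inner_scale (R : realType) (A : finType) (mu : A -> R)
    (f g : {ffun A -> R^o}) (c d : R) :
  inner mu (c *: f) (d *: g) = c * d * inner mu f g.
Proof.
by rewrite /inner mulr_sumr; apply: eq_bigr => x _; rewrite !ffunE /GRing.scale /=; ring.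
Qed.

(** * Types and projections of faces *)

Section Faces.
Variables (n : nat) (V : finType) (X : partite_complex n V).
Implicit Types (a t : {set V}) (w : top_face X) (S T : {set 'I_n}).

Lemma proj_sub T a : proj X T a \subset a.
Proof. by apply/fintype.subsetP => v; rewrite inE => /andP[]. Qed.

Lemma eq_projW S T a t : (forall i, i \in S -> i \in T) ->
  proj X T a = proj X T t -> proj X S a = proj X S t.
Proof.
move=> ST /setP e; apply/setP => v; rewrite !inE.
by have := e v; rewrite !inE; case h: (side X v \in S); rewrite ?andbF // ST.
Qed.

Lemma typU a t : typ X (a :|: t) = typ X a :|: typ X t.
Proof.
apply/setP => i; rewrite !inE; apply/existsP/orP.
  by move=> [v /andP[]]; rewrite inE => /orP[] va vi; [left|right];
     apply/existsP; exists v; rewrite va.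
by move=> [] /existsP[v /andP[va vi]]; exists v; rewrite inE va ?orbT.
Qed.

Lemma mem_typ a v : v \in a -> side X v \in typ X a.
Proof. by move=> va; rewrite inE; apply/existsP; exists v; rewrite va eqxx. Qed.

Lemma top_face_face w : val w \in faces X.
Proof. by have := valP w; rewrite inE => /andP[]. Qed.

Lemma top_face_side w i : exists v, [set x in val w | side X x == i] = [set v].
Proof.
have := valP w; rewrite inE => /andP[wX /eqP wn].
by apply/cards1P/eqP/faces_partite.
Qed.

Lemma typ_proj T w : typ X (proj X T (val w)) = T.
Proof.
apply/setP => i; rewrite inE; apply/existsP/idP.
  by move=> [v]; rewrite inE => /andP[/andP[_ vT] /eqP <-].
move=> iT; have [v /setP /(_ v)] := top_face_side w i.
by rewrite !inE eqxx => /andP[vw /eqP vi]; exists v; rewrite inE vw vi iT /=.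
Qed.

(** Since [w] has one vertex per side, if it contains [a] then it has no further vertex on the sides
    that [a] meets. Containment thus becomes the equation that defines the conditioning event. *)
Lemma sub_top_face a w : (a \subset val w) = (proj X (typ X a) (val w) == a).
Proof.
apply/idP/eqP => [aw|<-]; last exact: proj_sub.
apply/setP => v; rewrite inE; apply/andP/idP => [[vw]|va]; last first.
  by split; [exact: (fintype.subsetP aw)|exact: mem_typ].
rewrite inE => /existsP[x /andP[xa /eqP xv]].
have [y /setP e] := top_face_side w (side X v).
have := e v; have := e x; rewrite !inE vw xv eqxx (fintype.subsetP aw) //=.
by move=> /esym /eqP xy /esym /eqP vy; rewrite vy -xy.
Qed.

Lemma proj_faces_of_type T w : proj X T (val w) \in faces_of_type X T.
Proof.
rewrite inE typ_proj eqxx andbT.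
exact: faces_down (top_face_face w) (proj_sub _ _).
Qed.

Lemma proj_link_faces a T w : proj X (typ X a) (val w) = a ->
  proj X T (val w) \in link_faces X a T.
Proof.
move=> wa; rewrite inE proj_faces_of_type /=.
apply: faces_down (top_face_face w) _.
by rewrite finset.subUset proj_sub -{1}wa proj_sub.
Qed.

Lemma proj_typU a t w :
  (proj X (typ X (a :|: t)) (val w) == a :|: t) =
  (proj X (typ X a) (val w) == a) && (proj X (typ X t) (val w) == t).
Proof. by rewrite -!sub_top_face finset.subUset. Qed.

End Faces.

(** * The spaces $\mathcal U_T$ as functions of the coordinates outside [T] *)

Section Spaces.
Variables (R : realType) (n : nat) (V : finType) (X : partite_complex n V).
Implicit Types (f : {ffun top_face X -> R^o}) (T : {set 'I_n}).

(** Each generator depends only on the projection off [T]. Conversely, [f] is the combination of the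
    indicators [u_face a] weighted by its constant values on the fibres. *)
Lemma U_spaceP T f :
  f \in U_space R X T <->
  (forall w w', proj X (~: T) (val w) = proj X (~: T) (val w') -> f w = f w').
Proof.
split=> [fU w w' ww'|fT].
  rewrite (coord_span fU) !sum_ffunE; apply: eq_bigr => i _; rewrite !ffunE.
  congr (_ *: _).
  have /mapP[a] : (in_tuple [seq u_face R X a | a <- enum (faces_of_type X (~: T))])`_i
      \in [seq u_face R X a | a <- enum (faces_of_type X (~: T))].
    by apply: mem_nth; rewrite size_map -cardE ltn_ord.
  rewrite mem_enum inE => /andP[_ /eqP aT] ->.
  by rewrite !ffunE !sub_top_face aT ww'.
(* The coefficient of [a] is the value of [f] at any top face over [a]; by [fT] the choice does not
   matter. *)
pose c a := if [pick w : top_face X | proj X (~: T) (val w) == a] is Some w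
  then f w else 0.
have -> : f = \sum_(a in faces_of_type X (~: T)) c a *: u_face R X a.
  apply/ffunP => w; rewrite sum_ffunE.
  rewrite (bigD1 (proj X (~: T) (val w))) ?proj_faces_of_type //= big1 ?addr0.
    rewrite !ffunE proj_sub [_ *: _]mulr1 /c.
    by case: pickP => [w' /eqP /fT -> //|/(_ w)]; rewrite eqxx.
  move=> a; rewrite inE => /andP[/andP[_ /eqP aT]] aw.
  by rewrite !ffunE sub_top_face aT eq_sym (negPf aw) scaler0.
apply: memv_suml => a aT; apply/memvZ/memv_span/map_f.
by rewrite mem_enum.
Qed.

Lemma u_face_mem a T : [disjoint typ X a & T] -> u_face R X a \in U_space R X T.
Proof.
move=> aT; apply/U_spaceP => w w' ww'; rewrite !ffunE !sub_top_face.
rewrite (eq_projW _ ww') // => i ia; rewrite inE.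
by have := disjointFr aT ia => ->.
Qed.

End Spaces.

(** * Conditioning on a face, and the colored walk as a conditional expectation *)

Section Walk.
Variables (R : realType) (n : nat) (V : finType) (X : partite_complex n V).
Variable (pi : top_face X -> R).
Hypothesis pi_ge0 : forall w, 0 <= pi w.
Implicit Types (a : {set V}) (T I J : {set 'I_n}) (F G : top_face X -> R).

Definition fibre a : pred (top_face X) :=
  [pred w | proj X (typ X a) (val w) == a].

(* If the fibre of [a] is empty, then division by zero gives the value 0. *)
Definition cond_weight a (w : top_face X) : R :=
  (if fibre a w then pi w else 0) / Pr pi (fibre a).

(** The pullback of [h] along the projection to type [T]. The default 0 is taken only outside the
    link, hence never on the fibre of [a]. *)
Definition link_lift a T (h : {ffun link_face X a T -> R^o}) (w : top_face X) : R :=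
  oapp h 0 (insub (proj X T (val w))).

Lemma Pr_ge0 E : 0 <= Pr pi E.
Proof. exact: sumr_ge0. Qed.

Lemma cond_weight_ge0 a w : 0 <= cond_weight a w.
Proof. by rewrite divr_ge0 ?Pr_ge0 //; case: ifP. Qed.

Lemma link_lift_sum a T (h : {ffun link_face X a T -> R^o}) w :
  link_lift h w = \sum_(t | proj X T (val w) == val t) h t.
Proof.
rewrite /link_lift; case: insubP => [t _ <-|wN] /=.
  by rewrite (eq_bigl (pred1 t)) ?big_pred1_eq // => t' /=; rewrite eq_sym val_eqE.
by rewrite big1 // => t /eqP e; rewrite e (valP t) in wN.
Qed.

Lemma link_lift_fibre a T (h : {ffun link_face X a T -> R^o}) w
    (wT : proj X T (val w) \in link_faces X a T) :
  link_lift h w = h (exist (fun t => t \in link_faces X a T) _ wT).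
Proof. by rewrite /link_lift insubT. Qed.

Lemma link_distE a T t :
  link_dist pi a T t = \sum_(w | proj X T (val w) == t) cond_weight a w.
Proof.
rewrite /link_dist /cond_Pr /Pr mulr_suml.
rewrite [LHS]big_mkcond [RHS]big_mkcond; apply: eq_bigr => w _.
by rewrite /cond_weight /fibre /=; case: eqP; case: eqP => //=; rewrite mul0r.
Qed.

(** Change of variables: [link_marginal] is the pushforward of [cond_weight a] under projection to
    [T]. *)
Lemma link_expect a T (h : link_face X a T -> R) :
  \sum_t link_marginal pi t * h t =
  \sum_w cond_weight a w * \sum_(t | proj X T (val w) == val t) h t.
Proof.
under eq_bigr do rewrite /link_marginal link_distE mulr_suml.
rewrite (exchange_big_dep xpredT) //=; apply: eq_bigr => w _.
by rewrite mulr_sumr.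
Qed.

Lemma link_inner a T (f g : {ffun link_face X a T -> R^o}) :
  inner (@link_marginal R n V X pi a T) f g =
  \sum_w cond_weight a w * link_lift f w * link_lift g w.
Proof.
rewrite /inner; under eq_bigr do rewrite -mulrA.
rewrite (link_expect (fun t => f t * g t)); apply: eq_bigr => w _.
rewrite -mulrA; congr (_ * _); rewrite /link_lift.
case: insubP => [t _ <-|wN] /=.
  by rewrite (eq_bigl (pred1 t)) ?big_pred1_eq // => t' /=; rewrite eq_sym val_eqE.
by rewrite mul0r big1 // => t /eqP e; rewrite e (valP t) in wN.
Qed.

(** The chain rule for conditional probabilities: both sides are the joint probability of [tI] and
    [tJ] given [a]. *)
Lemma marginal_colored_walk a I J (tI : link_face X a I) (tJ : link_face X a J) :
  link_marginal pi tI * colored_walk pi tI tJ =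
  \sum_(w | (proj X I (val w) == val tI) && (proj X J (val w) == val tJ))
     cond_weight a w.
Proof.
have tIt : typ X (val tI) = I.
  by have := valP tI; rewrite !inE => /andP[/andP[_ /eqP]].
set E := fun w : top_face X => fibre a w && (proj X I (val w) == val tI).
have EE : forall w, fibre (a :|: val tI) w = E w.
  by move=> w; rewrite /fibre /= proj_typU tIt.
have mE : link_marginal pi tI = Pr pi E / Pr pi (fibre a).
  rewrite /link_marginal /link_dist /cond_Pr; congr (_ / _).
  by apply: eq_bigl => w; rewrite /E andbC.
pose P := Pr pi [pred w | (proj X J (val w) == val tJ) && E w].
have wE : colored_walk pi tI tJ = P / Pr pi E.
  rewrite /colored_walk /link_dist /cond_Pr; congr (_ / _); apply: eq_bigl => w /=;
    by rewrite -EE.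
transitivity (P / Pr pi (fibre a)); last first.
  rewrite /P /Pr mulr_suml [LHS]big_mkcond [RHS]big_mkcond; apply: eq_bigr => w _.
  rewrite /cond_weight /E /=.
  by do 2?[case: eqP => _] => //=; case: (fibre a w) => //=; rewrite mul0r.
(* If the event [E] conditioned on has mass 0, the joint mass [P] is at most that, so both sides are
   0 under the convention for division by zero. *)
rewrite mE wE; have [E0|E0] := eqVneq (Pr pi E) 0; last first.
  by rewrite mulrC mulrA divfK.
have -> : P = 0.
  apply/le_anti; rewrite Pr_ge0 andbT -E0 /P /Pr [leLHS]big_mkcond [leRHS]big_mkcond.
  by apply: ler_sum => w _ /=; case: (E w); case: eqP => //=.
by rewrite E0 !mul0r.
Qed.

(** Summing the chain rule over all pairs [tI], [tJ] turns the walk's bilinear form into the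
    conditional expectation, given [a], of the product of the two lifts. *)
Lemma walk_inner a I J (f : {ffun link_face X a I -> R^o})
    (g : {ffun link_face X a J -> R^o}) :
  inner (@link_marginal R n V X pi a I) f (walk_apply pi I g) =
  \sum_w cond_weight a w * link_lift f w * link_lift g w.
Proof.
rewrite /inner.
transitivity (\sum_tI \sum_tJ \sum_(w | (proj X I (val w) == val tI) &&
    (proj X J (val w) == val tJ)) cond_weight a w * (f tI * g tJ)).
  apply: eq_bigr => tI _; rewrite ffunE mulr_sumr; apply: eq_bigr => tJ _.
  by rewrite -mulr_suml -marginal_colored_walk; ring.
transitivity (\sum_tI \sum_tJ \sum_w (if (proj X I (val w) == val tI) &&
    (proj X J (val w) == val tJ) then cond_weight a w * (f tI * g tJ) else 0)).
  by apply: eq_bigr => tI _; apply: eq_bigr => tJ _; rewrite big_mkcond.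
under eq_bigr do rewrite exchange_big /=.
rewrite exchange_big /=; apply: eq_bigr => w _.
rewrite !link_lift_sum -mulrA mulr_suml mulr_sumr [RHS]big_mkcond; apply: eq_bigr => tI _.
case: eqP => [_|_]; last by rewrite big1.
by rewrite !mulr_sumr [RHS]big_mkcond; apply: eq_bigr => tJ _.
Qed.

(** * Bounds through the second singular value and its maximum *)

Lemma link_marginal_ge0 a T (t : link_face X a T) : 0 <= link_marginal pi t.
Proof. by rewrite divr_ge0 ?Pr_ge0. Qed.

Lemma walk_applyZ a I J (c : R) (g : {ffun link_face X a J -> R^o}) :
  walk_apply pi I (c *: g) = c *: walk_apply pi I g.
Proof.
apply/ffunP => t; rewrite !ffunE scaler_sumr; apply: eq_bigr => t' _.
by rewrite !ffunE /GRing.scale /=; ring.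
Qed.

(** A supremum dominates its set only when the set is bounded above; AM-GM on the lifts supplies the
    bound 1. *)
Lemma sigma2_ub a I J (f : {ffun link_face X a I -> R^o})
    (g : {ffun link_face X a J -> R^o}) :
  norm (@link_marginal R n V X pi a I) f = 1 ->
  norm (@link_marginal R n V X pi a J) g = 1 ->
  inner (@link_marginal R n V X pi a I) f [ffun=> 1] = 0 ->
  inner (@link_marginal R n V X pi a J) g [ffun=> 1] = 0 ->
  inner (@link_marginal R n V X pi a I) f (walk_apply pi I g) <= sigma2 pi a I J.
Proof.
move=> f1 g1 f0 g0; apply: ub_le_sup; last by exists f, g; split.
exists 1 => _ [f' [g' [f'1 g'1 _ _ ->]]]; rewrite walk_inner.
apply: le_trans (weighted_AMGM (cond_weight_ge0 a) _ _) _.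
rewrite -!link_inner -!norm_sqr ?f'1 ?g'1; [lra|exact: link_marginal_ge0..].
Qed.

(** Replacing [f] by its negative keeps all constraints and flips the sign of the value, so the
    supremum dominates some [r] and [- r]. With no admissible pair it is 0 by convention. *)
Lemma sigma2_ge0 a I J : 0 <= sigma2 pi a I J.
Proof.
have [[r [f [g [f1 g1 f0 g0 _]]]]|] := pselect (exists r : R,
  exists (f : {ffun link_face X a I -> R^o}) (g : {ffun link_face X a J -> R^o}),
    [/\ norm (@link_marginal R n V X pi a I) f = 1,
        norm (@link_marginal R n V X pi a J) g = 1,
        inner (@link_marginal R n V X pi a I) f [ffun=> 1] = 0,
        inner (@link_marginal R n V X pi a J) g [ffun=> 1] = 0
      & r = inner (@link_marginal R n V X pi a I) f (walk_apply pi I g)]); last first.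
  move=> N; rewrite /sigma2 sup_out // => -[[r rP] _]; apply: N.
  by exists r.
have le_s := sigma2_ub f1 g1 f0 g0.
have innerN : inner (@link_marginal R n V X pi a I) (-1 *: f) (1 *: [ffun=> 1]) = 0.
  by rewrite inner_scale f0 mulr0.
rewrite scale1r in innerN.
have Nf1 : norm (@link_marginal R n V X pi a I) (-1 *: f) = 1.
  by rewrite /norm inner_scale mulrNN !mul1r.
have := sigma2_ub Nf1 g1 innerN g0.
rewrite -[walk_apply _ _ _]scale1r !inner_scale; lra.
Qed.

(** By homogeneity this reduces to unit vectors; when one of the norms is 0 both sides vanish. *)
Lemma sigma2_bound a I J (f : {ffun link_face X a I -> R^o})
    (g : {ffun link_face X a J -> R^o}) :
  inner (@link_marginal R n V X pi a I) f [ffun=> 1] = 0 ->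
  inner (@link_marginal R n V X pi a J) g [ffun=> 1] = 0 ->
  inner (@link_marginal R n V X pi a I) f (walk_apply pi I g) <=
  sigma2 pi a I J * (norm (@link_marginal R n V X pi a I) f *
                     norm (@link_marginal R n V X pi a J) g).
Proof.
move=> f0 g0; set p := norm _ f; set q := norm _ g.
have p2 : p ^+ 2 = _ := norm_sqr f (@link_marginal_ge0 a I).
have q2 : q ^+ 2 = _ := norm_sqr g (@link_marginal_ge0 a J).
have [pz|pn0] := eqVneq p 0.
  rewrite pz mul0r mulr0 walk_inner weighted_sum_eq0 //; first exact: cond_weight_ge0.
  by rewrite -link_inner -p2 pz expr0n.
have [qz|qn0] := eqVneq q 0.
  rewrite qz !mulr0 walk_inner.
  (* Exchanging the factors brings the lift of [g], the one of norm 0, to the place where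
     [weighted_sum_eq0] expects it. *)
  under eq_bigr do rewrite mulrAC.
  rewrite weighted_sum_eq0 //; first exact: cond_weight_ge0.
  by rewrite -link_inner -q2 qz expr0n.
have pp : 0 < p by rewrite lt0r pn0 sqrtr_ge0.
have qp : 0 < q by rewrite lt0r qn0 sqrtr_ge0.
have unit T (h : {ffun link_face X a T -> R^o}) (r : R) : 0 < r ->
    r ^+ 2 = inner (@link_marginal R n V X pi a T) h h ->
    norm (@link_marginal R n V X pi a T) (r^-1 *: h) = 1.
  move=> r0 r2; rewrite /norm inner_scale -r2 expr2 mulrACA mulVf ?gt_eqF //.
  by rewrite mulr1 sqrtr1.
have orth T (h : {ffun link_face X a T -> R^o}) (r : R) :
    inner (@link_marginal R n V X pi a T) h [ffun=> 1] = 0 ->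
    inner (@link_marginal R n V X pi a T) (r *: h) [ffun=> 1] = 0.
  by move=> h0; rewrite -[[ffun=> 1]]scale1r inner_scale h0 mulr0.
have := sigma2_ub (unit _ _ _ pp p2) (unit _ _ _ qp q2) (orth _ _ _ f0) (orth _ _ _ g0).
rewrite walk_applyZ inner_scale -invfM mulrC ler_pdivrMr //.
by rewrite mulr_gt0.
Qed.

Lemma sigma2_le_epsilon a I J : a \in faces_of_type X (~: (I :|: J)) ->
  sigma2 pi a I J <= epsilon pi I J.
Proof.
move=> aT; apply: ub_le_sup; last by exists a.
(* As the values of [sigma2] are nonnegative, their sum over all vertex sets bounds each of them. *)
exists (\sum_(b : {set V}) sigma2 pi b I J) => _ [b _ ->].
rewrite (bigD1 b) //= lerDl; apply: sumr_ge0 => c _; exact: sigma2_ge0.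
Qed.

(** * The inequality on one fibre, and summation over the fibres *)

Lemma cond_weight_sum a F G :
  \sum_w cond_weight a w * F w * G w =
  (\sum_(w | fibre a w) pi w * F w * G w) / Pr pi (fibre a).
Proof.
rewrite mulr_suml [RHS]big_mkcond; apply: eq_bigr => w _.
by rewrite /cond_weight; case: ifP => _; [ring|rewrite !mul0r].
Qed.

(** A one-sided inverse of [link_lift] on the fibre of [a]: the value is read off at an arbitrary
    top face over [t], and is independent of that choice when [F] depends only on the coordinates in
    [typ X a] and [T]. *)
Definition link_restr a T F : {ffun link_face X a T -> R^o} :=
  [ffun t => if [pick w | fibre a w && (proj X T (val w) == val t)] is Some w
             then F w else 0].

Lemma link_restrK a T F w :
  (forall w w', proj X (typ X a :|: T) (val w) = proj X (typ X a :|: T) (val w') ->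
     F w = F w') ->
  fibre a w -> link_lift (link_restr a T F) w = F w.
Proof.
move=> FT aw; have wT := proj_link_faces T (eqP aw).
rewrite (link_lift_fibre _ wT) ffunE /=.
case: pickP => [w' /andP[aw' /eqP w'T]|/(_ w)]; last by rewrite aw eqxx.
apply: FT; apply/setP => v; rewrite !inE.
have /setP/(_ v) := w'T; have /setP/(_ v) := eqP aw'; have /setP/(_ v) := eqP aw.
by rewrite !inE !andb_orr => -> -> ->.
Qed.

(** The zero sums are the orthogonality to constants that [sigma2_bound] asks for, once [u] and [v]
    have been moved to the link of [a]. *)
Lemma fibre_bound a I J (u v : top_face X -> R) :
  a \in faces_of_type X (~: (I :|: J)) ->
  (forall w w', proj X (~: I) (val w) = proj X (~: I) (val w') -> u w = u w') ->
  (forall w w', proj X (~: J) (val w) = proj X (~: J) (val w') -> v w = v w') ->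
  \sum_(w | fibre a w) pi w * u w = 0 ->
  \sum_(w | fibre a w) pi w * v w = 0 ->
  \sum_(w | fibre a w) pi w * u w * v w <=
  epsilon pi I J * ((\sum_(w | fibre a w) pi w * u w * u w +
                     \sum_(w | fibre a w) pi w * v w * v w) / 2).
Proof.
move=> aS uI vJ u0 v0.
have [p0|p_neq0] := eqVneq (Pr pi (fibre a)) 0.
  have pi0 w : fibre a w -> pi w = 0 by apply: (psumr_eq0P _ p0).
  by rewrite !big1 ?addr0 ?mul0r ?mulr0 // => w /pi0 ->; rewrite !mul0r.
have p_gt0 : 0 < Pr pi (fibre a) by rewrite lt0r p_neq0 Pr_ge0.
have aT : typ X a = ~: (I :|: J) by move: aS; rewrite inE => /andP[_ /eqP].
pose f := link_restr a I v; pose g := link_restr a J u.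
have fE w : fibre a w -> link_lift f w = v w.
  apply: link_restrK => w1 w2 e; apply: vJ; apply: eq_projW e => i.
  by rewrite aT !inE; case: (i \in I); case: (i \in J).
have gE w : fibre a w -> link_lift g w = u w.
  apply: link_restrK => w1 w2 e; apply: uI; apply: eq_projW e => i.
  by rewrite aT !inE; case: (i \in I); case: (i \in J).
have lift1 T w : fibre a w -> link_lift ([ffun=> 1] : {ffun link_face X a T -> R^o}) w = 1.
  by move=> aw; rewrite (link_lift_fibre _ (proj_link_faces T (eqP aw))) ffunE.
have f0 : inner (@link_marginal R n V X pi a I) f [ffun=> 1] = 0.
  rewrite link_inner cond_weight_sum (eq_bigr (fun w => pi w * v w)) ?v0 ?mul0r //.
  by move=> w aw; rewrite fE // lift1 // mulr1.
have g0 : inner (@link_marginal R n V X pi a J) g [ffun=> 1] = 0.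
  rewrite link_inner cond_weight_sum (eq_bigr (fun w => pi w * u w)) ?u0 ?mul0r //.
  by move=> w aw; rewrite gE // lift1 // mulr1.
have f2 : norm (@link_marginal R n V X pi a I) f ^+ 2 =
    (\sum_(w | fibre a w) pi w * v w * v w) / Pr pi (fibre a).
  rewrite norm_sqr; last exact: link_marginal_ge0.
  rewrite link_inner cond_weight_sum; congr (_ / _).
  by apply: eq_bigr => w aw; rewrite fE.
have g2 : norm (@link_marginal R n V X pi a J) g ^+ 2 =
    (\sum_(w | fibre a w) pi w * u w * u w) / Pr pi (fibre a).
  rewrite norm_sqr; last exact: link_marginal_ge0.
  rewrite link_inner cond_weight_sum; congr (_ / _).
  by apply: eq_bigr => w aw; rewrite gE.
have := sigma2_bound f0 g0.
rewrite walk_inner cond_weight_sum ler_pdivrMr //.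
rewrite (eq_bigr (fun w => pi w * u w * v w)); last first.
  by move=> w aw; rewrite fE // gE // mulrAC.
move=> /le_trans; apply.
set x := norm _ f in f2 *; set y := norm _ g in g2 *.
have -> : \sum_(w | fibre a w) pi w * u w * u w = y ^+ 2 * Pr pi (fibre a).
  by rewrite g2 divfK.
have -> : \sum_(w | fibre a w) pi w * v w * v w = x ^+ 2 * Pr pi (fibre a).
  by rewrite f2 divfK.
rewrite -mulrDl -[X in _ <= _ * X]mulrAC [leRHS]mulrA ler_pM2r //.
apply: ler_pM; [exact: sigma2_ge0|by rewrite mulr_ge0 ?sqrtr_ge0| |].
  exact: sigma2_le_epsilon.
by have := sqr_ge0 (x - y); nra.
Qed.

Lemma epsilon_ge0 I J : top_face X -> 0 <= epsilon pi I J.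
Proof.
move=> w; apply: le_trans (sigma2_ge0 _ I J) (sigma2_le_epsilon _).
exact: proj_faces_of_type w.
Qed.

Lemma sum_fibres T (F : top_face X -> R) :
  \sum_w F w = \sum_(a in faces_of_type X T) \sum_(w | fibre a w) F w.
Proof.
rewrite (partition_big (fun w : top_face X => proj X T (val w))
  (mem (faces_of_type X T))) => [|w _]; last exact: proj_faces_of_type.
apply: eq_bigr => a /=; rewrite inE => /andP[_ /eqP aT].
by apply: eq_bigl => w; rewrite /fibre /= aT.
Qed.

Lemma orthogonal_fibre_sum0 a I J (u : {ffun top_face X -> R^o}) :
  a \in faces_of_type X (~: (I :|: J)) ->
  (forall z, z \in (U_space R X I :&: U_space R X J)%VS -> inner pi u z = 0) ->
  \sum_(w | fibre a w) pi w * u w = 0.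
Proof.
rewrite inE => /andP[_ /eqP aT] orth.
rewrite -[RHS](orth (u_face R X a)); last first.
  rewrite memv_cap !u_face_mem // aT finset.disjoints_subset finset.setCS.
    exact: finset.subsetUr.
  exact: finset.subsetUl.
rewrite /inner [LHS]big_mkcond; apply: eq_bigr => w _; rewrite ffunE sub_top_face.
by rewrite /fibre /=; case: eqP; rewrite ?mulr1 ?mulr0.
Qed.

End Walk.

Theorem theorem3p5 (R : realType) (n : nat) (V : finType)
    (X : partite_complex n V) (pi : top_face X -> R)
    (pi_dist : full_support_distribution pi)
    (I J : {set 'I_n}) (IJ_disjoint : [disjoint I & J]) :
  cos_subspaces pi (U_space R X I) (U_space R X J) <= epsilon pi I J.
Proof.
have [pi_gt0 pi1] := pi_dist.
have pi_ge0 w : 0 <= pi w by exact: ltW.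
have [w0 _] : exists w0 : top_face X, True.
  case: (pickP (fun _ : top_face X => true)) => [w0 _|none]; first by exists w0.
  by move: pi1; rewrite big_pred0 // => /esym/eqP; rewrite oner_eq0.
have eps_ge0 : 0 <= epsilon pi I J by exact: epsilon_ge0.
rewrite /cos_subspaces; set E := (E in sup E).
have [E0|/set0P[r0 Er0]] := eqVneq E set0%classic; first by rewrite E0 sup0.
apply: sup_le_ub; first by exists r0.
move=> _ [u [v [[/U_spaceP uI u_orth] [/U_spaceP vJ v_orth] u1 v1 ->]]].
have u2 : inner pi u u = 1 by rewrite -norm_sqr // u1 expr1n.
have v2 : inner pi v v = 1 by rewrite -norm_sqr // v1 expr1n.
have -> : epsilon pi I J = epsilon pi I J * ((inner pi u u + inner pi v v) / 2).
  by rewrite u2 v2; lra.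
rewrite /inner !(sum_fibres (~: (I :|: J))) -big_split /= mulr_suml mulr_sumr.
apply: ler_sum => a aT; apply: fibre_bound => //.
  exact: orthogonal_fibre_sum0 aT u_orth.
exact: orthogonal_fibre_sum0 aT v_orth.
Qed.
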